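(* For a group $G$, the following are equivalent: (1) $G$ is non amenable. (2) There is a finite $A \subseteq G$ and an unbalanced collection $\mathcal{Y}$ of subsets of $A$ which is realized in $G$. (3) There is a finite $A \subseteq G$ for which there is no finite $B \subseteq G$ which is $0$-Ramsey with respect to $A$.
   Context: $G$ is a discrete group. For a set $A$, $P(A)$ denotes the collection of all finitely additive probability measures defined on all subsets of $A$; for $A \subseteq G$, members of $P(A)$ are identified with measures on $G$ concentrated on $A$. $G$ is amenable if there is a $\mu \in P(G)$ with $\mu(gE) = \mu(E)$ for all $g \in G$ and $E \subseteq G$, where $gE=\{gx : x\in E\}$. For a finite set $A \subseteq G$, $E \subseteq G$ and $g \in G$, let $X^A_E(g) = \{a \in A : ag \in E\}$ and $\mathcal{X}^A_E = \{X^A_E(g) : g \in G\}$. A collection $\mathcal{Y}$ of subsets of $A$ is realized in $G$ if $\mathcal{Y} = \mathcal{X}^A_E$ for some $E \subseteq G$. A collection $\mathcal{Y}$ of subsets of a finite set $A$ is $\epsilon$-balanced if there is a convex combination $v : A \to \mathbb{R}$ of the characteristic functions of its elements such that $\max(v) - \min(v) \leq \epsilon$ (i.e. $|v(a) - v(a')| \leq \epsilon$ for all $a,a' \in A$). Balanced means $0$-balanced; unbalanced means not balanced. The group operation is extended bilinearly to $\ell^1(G)$ by $\mu\nu(E) = \sum_{xy \in E} \mu(\{x\})\nu(\{y\})$ (sum over pairs $(x,y)$ with $xy\in E$). For finite $A \subseteq G$, $P(A)\nu = \{\mu\nu : \mu \in P(A)\}$. If $A$ and $B$ are finite subsets of $G$,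 then $B$ is $0$-Ramsey with respect to $A$ if for every $E \subseteq B$ there is a $\nu \in P(B)$ such that $P(A)\nu \subseteq P(B)$ and $\mu\nu(E) = \mu'\nu(E)$ for all $\mu, \mu' \in P(A)$. *)

(* Defs.v *)
From mathcomp Require Import all_boot all_order all_algebra.
From mathcomp Require Import boolp classical_sets functions cardinality.
From mathcomp Require Import reals ereal numfun esum.

Set Implicit Arguments.
Unset Strict Implicit.
Unset Printing Implicit Defensive.

Import Order.TTheory GRing.Theory Num.Theory.

Local Open Scope classical_set_scope.
Local Open Scope ring_scope.

(* Members of P(A) are represented by set functions on all of T that are
   concentrated on A. *)
Definition finadd_prob (R : realType) (T : Type) (A : set T) :
    set (set T -> R) :=
  [set mu : set T -> R |
    [/\ forall E, 0 <= mu E,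
        forall E F, E `&` F = set0 -> mu (E `|` F) = mu E + mu F,
        mu setT = 1
      & mu A = 1]].

Definition amenable (R : realType) (G : groupType) : Prop :=
  exists2 mu : set G -> R, finadd_prob setT mu &
    forall (g : G) (E : set G), mu [set (g * x)%g | x in E] = mu E.

Definition Xset (G : groupType) (A E : set G) (g : G) : set G :=
  [set a | A a /\ E (a * g)%g].

Definition Xcoll (G : groupType) (A E : set G) : set (set G) :=
  range (Xset A E).

Definition realized (G : groupType) (A : set G) (Y : set (set G)) : Prop :=
  exists E : set G, Y = Xcoll A E.

(* When the members of Y are subsets of A, v vanishes outside A and is thus
   determined by its restriction to A. *)
Definition convex_comb_indic (R : realType) (T : Type) (Y : set (set T))
    (v : T -> R) : Prop :=
  exists (n : nat) (c : 'I_n -> R) (S : 'I_n -> set T),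
    [/\ forall i, 0 <= c i,
        \sum_(i < n) c i = 1,
        forall i, Y (S i)
      & forall x, v x = \sum_(i < n) c i * \1_(S i) x].

Definition eps_balanced (R : realType) (T : Type) (eps : R) (A : set T)
    (Y : set (set T)) : Prop :=
  exists2 v : T -> R, convex_comb_indic Y v &
    forall a a' : T, A a -> A a' -> `|v a - v a'| <= eps.

Definition balanced (R : realType) (T : Type) (A : set T)
    (Y : set (set T)) : Prop :=
  eps_balanced (0 : R) A Y.

(* \esum is meaningful for nonnegative families only, so the absolutely
   convergent sum of mu {x} * nu {y} over the pairs (x, y) with x y in E is the
   difference of the sums of the positive and negative parts. *)
Definition conv (R : realType) (G : groupType) (mu nu : set G -> R)
    (E : set G) : R :=
  let f := fun p : G * G => (mu [set p.1] * nu [set p.2])%:E in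
  let D := [set p : G * G | E (p.1 * p.2)%g] in
  fine (\esum_(p in D) f^\+%E p - \esum_(p in D) f^\-%E p)%E.

Definition zero_ramsey (R : realType) (G : groupType) (A B : set G) : Prop :=
  forall E : set G, E `<=` B ->
    exists nu : set G -> R,
      [/\ finadd_prob B nu,
          [set conv mu nu | mu in finadd_prob A] `<=` finadd_prob B
        & forall mu mu' : set G -> R, finadd_prob A mu -> finadd_prob A mu' ->
            conv mu nu E = conv mu' nu E].

(* Main.v *)
(* Compactness (an ultrafilter on the finite subsets of G) turns "every X^A_E is
   balanced" into a finite B that serves all E at once, which is the Ramsey
   property up to enlarging B.  An invariant mean balances every X^A_E, since it
   agrees with a finitely supported mean on any finitely many sets.

   The main point is that balancing single sets already gives amenability.
   First, a function f : G -> [0,1] is replaced by a set E whose averages over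
   all translates of a large finite Q are close to those of f: E is a random set
   with P(x in E) = f x, and the Lovasz local lemma controls all translates
   simultaneously.  Balancing E thus almost balances f.  Next, finitely many
   functions are balanced simultaneously by iteration: if nu0 balances
   f_0, ..., f_(n-1) on a large finite set and nu1 balances x |-> f_n (x nu0),
   then nu1 nu0 balances f_0, ..., f_n.  Finitely supported means that are
   almost invariant on more and more sets converge, along an ultrafilter, to an
   invariant mean. *)
Require Import Defs.
From mathcomp Require Import all_boot all_order all_algebra.
From mathcomp Require Import boolp classical_sets functions cardinality.
From mathcomp Require Import reals ereal numfun esum fsbigop.
From mathcomp Require Import filter sequences exp.
From mathcomp Require Import ring lra.

Set Implicit Arguments.
Unset Strict Implicit.
Unset Printing Implicit Defensive.

Import Order.TTheory GRing.Theory Num.Theory.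

Local Open Scope classical_set_scope.
Local Open Scope ring_scope.

(** * Independent random sets and the local lemma *)

Section RandomSubset.
Variables (R : realType) (T : eqType) (p : T -> R).
Hypothesis p01 : forall x, 0 <= p x <= 1.
Implicit Types (E : T -> bool) (F : (T -> bool) -> R) (l : seq T) (U : pred T).

Definition update E x b : T -> bool := fun y => if y == x then b else E y.

(* Expected value of [F] after resampling the points of [l] in [E]: each [x] is
   put in the random set independently, with probability [p x]. *)
Fixpoint expect l F E : R :=
  if l is x :: l' then
    p x * expect l' F (update E x true)
    + (1 - p x) * expect l' F (update E x false)
  else F E.

Definition depends_on U F := forall E E', {in U, E =1 E'} -> F E = F E'.

Lemma expect_depends l U F : depends_on U F -> depends_on U (expect l F).
Proof.
move=> FU; elim: l => [|x l IHl] //= E E' EE'.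
by congr (_ * _ + _ * _); apply: IHl => y yU; rewrite /update;
  case: eqP => // _; apply: EE'.
Qed.

(** Independence: each resampled point lies either in [U] or outside it, so one of the two factors
    does not see it and leaves the two-term average. *)
Lemma expectM l U F F' E :
  depends_on U F -> depends_on (predC U) F' ->
  expect l (fun E => F E * F' E) E = expect l F E * expect l F' E.
Proof.
move=> FU F'U; elim: l E => [|x l IHl] //= E.
have /orP[xU|xU] : U x || ~~ U x by case: (U x).
- have e b : expect l F' (update E x b) = expect l F' E.
    apply: (expect_depends _ F'U) => y; rewrite /update; case: eqP => // ->.
    by rewrite !inE xU.
  by rewrite !IHl !e; ring.
have e b : expect l F (update E x b) = expect l F E.
  apply: (expect_depends _ FU) => y; rewrite /update; case: eqP => // ->.
  by rewrite unfold_in (negPf xU).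
by rewrite !IHl !e; ring.
Qed.

Lemma expectD l F F' E :
  expect l (fun E => F E + F' E) E = expect l F E + expect l F' E.
Proof. by elim: l E => [|x l IHl] //= E; rewrite !IHl; ring. Qed.

Lemma expect_cst l c E : expect l (fun=> c) E = c.
Proof. by elim: l E => [|x l IHl] //= E; rewrite !IHl; ring. Qed.

Lemma expect_sum (I : Type) (r : seq I) l (F : I -> (T -> bool) -> R) E :
  expect l (fun E => \sum_(i <- r) F i E) E = \sum_(i <- r) expect l (F i) E.
Proof.
elim: r => [|i r IHr].
  rewrite big_nil -[RHS](expect_cst l 0 E); congr expect.
  by apply/funext => E'; rewrite big_nil.
rewrite big_cons -IHr -expectD; congr expect.
by apply/funext => E'; rewrite big_cons.
Qed.

Lemma expect_le l F F' E :
  (forall E, F E <= F' E) -> expect l F E <= expect l F' E.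
Proof.
move=> FF'; elim: l E => [|x l IHl] //= E.
have /andP[p0 p1] := p01 x.
by apply: lerD; apply: ler_wpM2l; rewrite ?subr_ge0.
Qed.

(** Repetitions in [l] do no harm: a later update of [x] overrides the earlier ones, so only the
    last occurrence counts. *)
Lemma expect_point l x (phi : bool -> R) E : x \in l ->
  expect l (fun E => phi (E x)) E = p x * phi true + (1 - p x) * phi false.
Proof.
have off l' b E' : x \notin l' ->
    expect l' (fun E => phi (E x)) (update E' x b) = phi b.
  elim: l' E' => [|y l' IHl'] E' /=; first by rewrite /update eqxx.
  rewrite inE negb_or => /andP[xy xl'].
  have e c :
      expect l' (fun E => phi (E x)) (update (update E' x b) y c) = phi b.
    rewrite -(IHl' (update (update E' x b) y c)) //.
    apply: (@expect_depends _ (pred1 x)) => [E1 E2 /(_ x)|z].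
      by rewrite !inE eqxx => ->.
    by rewrite inE => /eqP ->; rewrite /update eqxx (negPf xy).
  by rewrite !e; ring.
elim: l E => [//|y l IHl] E; rewrite inE /= => /orP xl.
have [xl'|xl'] := boolP (x \in l); first by rewrite !IHl //; ring.
by case: xl => [/eqP <-|/idPn//]; rewrite !off.
Qed.

Lemma expect_prod l (s : seq T) (phi : T -> bool -> R) E :
  uniq s -> {subset s <= l} ->
  expect l (fun E => \prod_(x <- s) phi x (E x)) E =
  \prod_(x <- s) (p x * phi x true + (1 - p x) * phi x false).
Proof.
elim: s => [|x s IHs] /= => [_ _|/andP[xs us] sl].
  rewrite big_nil -[RHS](expect_cst l 1 E); congr expect.
  by apply/funext => E'; rewrite big_nil.
rewrite big_cons -IHs// ?(expect_point _ _ E (sl x _)) ?inE ?eqxx//; last first.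
  by move=> y ys; apply: sl; rewrite inE ys orbT.
rewrite -(@expect_point l x (phi x) E) ?sl ?inE ?eqxx//.
rewrite -(@expectM l (pred1 x)).
- by congr expect; apply/funext => E'; rewrite big_cons.
- by move=> E1 E2 /(_ x); rewrite !inE eqxx => ->.
- move=> E1 E2 E12; apply: eq_big_seq => y ys; rewrite E12// !inE.
  by apply: contraNneq xs => <-.
Qed.

(* Lovasz local lemma, by the counting argument: forbidding one more event
   keeps at least a proportion [b] of the mass of the good sets. *)
Lemma local_lemma (I : eqType) (bad : I -> (T -> bool) -> bool)
    (U : I -> seq T) (l : seq T) (D : nat) (b : R) E0 (S : seq I) :
  (forall i, depends_on (mem (U i)) (fun E => (bad i E)%:R)) ->
  (forall i (s : seq I), uniq s ->
     (size [seq j <- s | has (mem (U i)) (U j)] <= D)%N) ->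
  0 < b -> b <= 1 ->
  (forall i, i \in S ->
     expect l (fun E => (bad i E)%:R) E0 <= (1 - b) * b ^+ D) ->
  exists E, forall i, i \in S -> ~~ bad i E.
Proof.
move=> badU degD b0 b1 badP.
pose good s E : R := \prod_(i <- s) (~~ bad i E)%:R.
pose mass s := expect l (good s) E0.
have good01 s E : 0 <= good s E <= 1.
  rewrite /good; elim: s => [|i s IHs]; first by rewrite big_nil ler01 lexx.
  by rewrite big_cons; case: (bad i E); rewrite /= ?mul0r ?mul1r ?lexx ?ler01.
have mass_ge0 s : 0 <= mass s.
  rewrite -(expect_cst l 0 E0); apply: expect_le => E.
  by have /andP[] := good01 s E.
(* The bound is needed for every head event and shorter list, hence the induction on a bound [n] for
   the length. *)
have mass_cons_le n : forall s i, (size s <= n)%N -> uniq (i :: s) ->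
    {subset i :: s <= S} -> b * mass s <= mass (i :: s).
  elim: n => [|n IHn] s i.
    rewrite leqn0 => /nilP -> _ iS.
    have := badP i (iS i (mem_head _ _)).
    rewrite /mass.
    have -> : good [::] = fun=> 1 by apply/funext => E; rewrite /good big_nil.
    have -> : good [:: i] = fun E => 1 + (-1) * (bad i E)%:R.
      apply/funext => E; rewrite /good big_seq1.
      by case: (bad i E) => /=; ring.
    rewrite expectD (@expectM _ xpred0) //; last first.
      by move=> E1 E2 E12; apply: badU => y _; apply: E12.
    rewrite !expect_cst => h.
    have bD : b ^+ D <= 1 by apply: exprn_ile1 => //; apply: ltW.
    have : (1 - b) * b ^+ D <= 1 - b by rewrite ler_piMr// subr_ge0.
    by lra.
  move=> sz /= /andP[iNs us] isS.
  (* [C] collects the events of [s] that share a point with event [i]; those in [N] are jointly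
     independent of it. *)
  set C := [seq j <- s | has (mem (U i)) (U j)].
  set N := [seq j <- s | ~~ has (mem (U i)) (U j)].
  have uN : uniq N by exact: filter_uniq.
  have pCN : perm_eq (C ++ N) s by apply/permPl/perm_filterC.
  have uCN : uniq (C ++ N) by rewrite (perm_uniq pCN).
  have CNs : {subset C ++ N <= s} by move=> j; rewrite (perm_mem pCN).
  have sCN : (size (C ++ N) <= n.+1)%N.
    by rewrite (perm_size pCN).
  have massCN : mass s = mass (C ++ N).
    rewrite /mass; congr expect; apply/funext => E.
    by apply: perm_big; rewrite perm_sym.
  (* Putting the events of [C] back in front of [N] one at a time costs a factor [b] each, by
     induction; there are at most [D] of them. *)
  have step : b ^+ size C * mass N <= mass (C ++ N).
    move: uCN CNs sCN; elim: (C) => [|j C' IHC] /=.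
      by rewrite expr0 mul1r.
    move=> /andP[jC uC] CNs sCN.
    have le1 : b ^+ size C' * mass N <= mass (C' ++ N).
      apply: IHC => //; last exact: ltnW.
      by move=> k kC; apply: CNs; rewrite inE kC orbT.
    have le2 : b * mass (C' ++ N) <= mass (j :: C' ++ N).
      apply: IHn => //; first by rewrite /= jC uC.
      by move=> k kC; apply: isS; rewrite inE CNs ?orbT.
    by rewrite exprS -mulrA; apply: le_trans le2; rewrite ler_pM2l.
  have massN : b ^+ D * mass N <= mass s.
    rewrite massCN; apply: le_trans step; apply: ler_wpM2r => //.
    by apply: ler_wiXn2l; rewrite ?(ltW b0) //; apply: degD.
  have indep : expect l (fun E => (bad i E)%:R * good N E) E0 =
      expect l (fun E => (bad i E)%:R) E0 * mass N.
    apply: (@expectM l (mem (U i))) => // E1 E2 E12.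
    apply: eq_big_seq => j; rewrite mem_filter => /andP[ij _].
    have := @badU j E1 E2; case: (bad j E1) (bad j E2) => -[] //= h.
      have /eqP : (1 : R) = 0%:R by apply: h => x xj; apply: E12;
        rewrite !inE; apply: contra ij => xi; apply/hasP; exists x.
      by rewrite oner_eq0.
    have /eqP : (0%:R : R) = 1 by apply: h => x xj; apply: E12;
        rewrite !inE; apply: contra ij => xi; apply/hasP; exists x.
    by rewrite eq_sym oner_eq0.
  have split_bad : mass s =
      mass (i :: s) + expect l (fun E => (bad i E)%:R * good s E) E0.
    rewrite -expectD; congr expect; apply/funext => E.
    by rewrite /good big_cons; case: (bad i E) => /=; ring.
  have badN : expect l (fun E => (bad i E)%:R * good s E) E0 <=
      expect l (fun E => (bad i E)%:R * good N E) E0.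
    apply: expect_le => E; apply: ler_wpM2l => //.
    have -> : good s E = good (C ++ N) E.
      by apply: perm_big; rewrite perm_sym.
    rewrite /good big_cat /=.
    have /andP[h0 _] := good01 N E.
    by have /andP[_ h1] := good01 C E; apply: ler_piMl.
  have bad_le : expect l (fun E => (bad i E)%:R) E0 * mass N <=
      (1 - b) * mass s.
    apply: (@le_trans _ _ ((1 - b) * b ^+ D * mass N)).
      by apply: ler_wpM2r => //; apply: badP; apply: isS; apply: mem_head.
    by rewrite -mulrA; apply: ler_wpM2l; rewrite ?subr_ge0.
  by rewrite indep in badN; lra.
have massS : 0 < mass (undup S).
  have : {subset undup S <= S} by move=> i; rewrite mem_undup.
  elim: (undup S) (undup_uniq S) => [|i s IHs] us sS.
    have -> : mass [::] = 1 :> R.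
      rewrite -(expect_cst l 1 E0); congr expect.
      by apply/funext => E; rewrite /good big_nil.
    exact: ltr01.
  apply: lt_le_trans (mass_cons_le (size s) s i _ us sS) => //.
  apply: mulr_gt0 => //; apply: IHs; first by case/andP: us.
  by move=> j js; apply: sS; rewrite inE js orbT.
apply: contrapT => noE.
suff e0 : mass (undup S) = 0 by rewrite e0 ltxx in massS.
rewrite -(expect_cst l 0 E0); congr expect; apply/funext => E.
have [i iS iE] : exists2 i, i \in S & bad i E.
  apply: contrapT => h; apply: noE; exists E => i iS.
  by apply/negP => iE; apply: h; exists i.
by rewrite /good (big_rem i) ?mem_undup//= iE mul0r.
Qed.

End RandomSubset.

(** * Rounding a function to a set *)

Section Rounding.
Variable R : realType.

(** Inverting [1 - y <= expR (- y)] bounds [expR y] by [1 / (1 - y)]; the right-hand side times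
    [1 - y] is [1 + y ^+ 2 * (1 - 2 * y)], which is at least [1]. *)
Lemma expR_le_quadratic (y : R) : y <= 2^-1 -> expR y <= 1 + y + 2 * y ^+ 2.
Proof.
move=> y2; have e1 := expR_ge1Dx (- y); rewrite expRN in e1.
have y1 : 0 < 1 - y by lra.
have e0 := expR_gt0 y.
have e2 : expR y * (1 - y) <= 1.
  by rewrite -[leRHS](divff (lt0r_neq0 e0)) ler_pM2l.
have q0 : 1 <= (1 + y + 2 * y ^+ 2) * (1 - y).
  have -> : (1 + y + 2 * y ^+ 2) * (1 - y) = 1 + y ^+ 2 * (1 - 2 * y) by ring.
  have : 0 <= y ^+ 2 * (1 - 2 * y) by rewrite mulr_ge0 ?sqr_ge0//; lra.
  by lra.
by rewrite -(ler_pM2r y1); apply: le_trans q0.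
Qed.

(** Exponential moment of a centred Bernoulli variable: the linear terms cancel, and the quadratic
    ones add up to [2 * x ^+ 2 * (p * (1 - p))]. *)
Lemma bernoulli_mgf (p x : R) : 0 <= p <= 1 -> `|x| <= 2^-1 ->
  p * expR (x * (1 - p)) + (1 - p) * expR (x * (0 - p)) <= expR (2 * x ^+ 2).
Proof.
move=> /andP[p0 p1]; rewrite ler_norml => /andP[x1 x2].
have h1 : expR (x * (1 - p)) <= _ := expR_le_quadratic _.
have {}h1 := h1 ltac:(nra).
have h2 : expR (x * (0 - p)) <= _ := expR_le_quadratic _.
have {}h2 := h2 ltac:(nra).
apply: le_trans (expR_ge1Dx _).
apply: (le_trans (lerD (ler_wpM2l p0 h1) (ler_wpM2l _ h2))); first by lra.
have pp : p * (1 - p) <= 1 by nra.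
have xx := sqr_ge0 x.
rewrite [leLHS](_ : _ = 1 + 2 * x ^+ 2 * (p * (1 - p))); last by ring.
by rewrite lerD2l ler_piMr// mulr_ge0.
Qed.

Lemma bernoulli_ineq (x : R) n : 0 <= x <= 1 -> 1 - n%:R * x <= (1 - x) ^+ n.
Proof.
move=> /andP[x0 x1]; elim: n => [|n IHn]; first by rewrite mul0r subr0 expr0.
rewrite exprS; apply: (@le_trans _ _ ((1 - x) * (1 - n%:R * x))); last first.
  by apply: ler_wpM2l => //; lra.
have : 0 <= n%:R * x ^+ 2 by rewrite mulr_ge0 ?sqr_ge0.
by rewrite -natr1; lra.
Qed.

(** The cubic term of the exponential series alone suffices once [q] reaches [6 * c / k ^+ 3]. *)
Lemma expR_dominates_square (c k : R) : 0 < k -> exists n : nat,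
  forall q : nat, (n <= q)%N -> c * q%:R ^+ 2 <= expR (k * q%:R).
Proof.
move=> k0; exists (Num.bound (6 * c / k ^+ 3)) => q qn.
have k3 : 0 < k ^+ 3 by rewrite exprn_gt0.
have le : 6 * c <= q%:R * k ^+ 3.
  rewrite -ler_pdivrMr//; apply: le_trans (ler_norm _) _.
  apply: (le_trans (ltW (archi_boundP (normr_ge0 _)))).
  by rewrite ler_nat; apply: leq_trans qn; rewrite /Num.bound normr_id.
have kq : 0 <= k * q%:R by rewrite mulr_ge0 ?(ltW k0).
apply: le_trans (expR_ge1Dxn 2 kq).
have : 0 <= (q%:R * k ^+ 3 - 6 * c) * q%:R ^+ 2.
  by rewrite mulr_ge0 ?sqr_ge0// subr_ge0.
rewrite (_ : (3`!)%:R = 6) // => h.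
have -> : (k * q%:R) ^+ 3 / 6 = c * q%:R ^+ 2
    + (q%:R * k ^+ 3 - 6 * c) * q%:R ^+ 2 / 6 by field.
by lra.
Qed.

(* The set is random, containing [x] with probability [f x]: the sums over the
   translates [a Q g] then deviate only with exponentially small probability in
   [size Q], and each of these events is independent of all but polynomially
   many others. *)
Lemma rounding (G : groupType) (f : G -> R) (A Q B : seq G) (d : R) :
  (forall x, 0 <= f x <= 1) -> uniq Q -> (0 < size Q)%N -> 0 < d -> d <= 1 ->
  8 * (size A)%:R ^+ 3 * (size Q)%:R ^+ 2 <= expR (d ^+ 2 / 8 * (size Q)%:R) ->
  exists E : G -> bool, forall a g, a \in A -> g \in B ->
    `|\sum_(t <- Q) ((E (a * t * g)%g)%:R - f (a * t * g)%g)|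
      <= d * (size Q)%:R.
Proof.
move=> f01 uQ Q0 d0 d1 hQ.
have [->|A0] := eqVneq A [::]; first by exists xpred0.
pose dev a g E : R := \sum_(t <- Q) ((E (a * t * g)%g)%:R - f (a * t * g)%g).
pose bad g (E : G -> bool) := has (fun a => d * (size Q)%:R < `|dev a g E|) A.
pose AQ := [seq (a * t)%g | a <- A, t <- Q].
pose U g := [seq (x * g)%g | x <- AQ].
pose D := (size AQ * size AQ)%N.
pose l := flatten [seq U g | g <- B].
have sAQ : size AQ = (size A * size Q)%N by rewrite size_allpairs.
have D0 : (0 < D)%N.
  by rewrite /D sAQ !muln_gt0 Q0 !andbT andbb lt0n size_eq0.
(* The local lemma is used with [b = 1 - r]: since [D * r = 1 / 2], Bernoulli's inequality gives
   [b ^+ D >= 1 / 2], so a bad event may have probability up to [r / 2]. *)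
pose r : R := (2 * D%:R)^-1.
have DR : 1 <= D%:R :> R by rewrite ler1n.
have r0 : 0 < r by rewrite invr_gt0; lra.
have rD : D%:R * r = 2^-1 by rewrite /r; field; lra.
have r1 : r < 1 by nra.
have inU a t g : a \in A -> t \in Q -> (a * t * g)%g \in U g.
  by move=> aA tQ; apply: map_f; apply/allpairsP; exists (a, t).
have [E goodE] : exists E, forall g, g \in B -> ~~ bad g E.
  apply: (@local_lemma R G f f01 G bad U l D (1 - r) xpred0 B).
  - move=> g E E' EE'; congr (nat_of_bool _)%:R; apply: eq_in_has => a aA.
    congr (_ < `|_|); apply: eq_big_seq => t tQ.
    by rewrite (EE' (a * t * g)%g)//; apply: inU.
  (* If [U h] meets [U g] in [z = x * h] with [x] in [AQ], then [h = x^-1 * z]; this leaves at most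
     [D] choices of [h]. *)
  - move=> g s us; set s' := [seq j <- s | _].
    rewrite /D -[X in (_ * X)%N](size_map (fun x => x * g)%g).
    rewrite -(size_allpairs (fun x y => x^-1 * y)%g).
    apply: uniq_leq_size; first exact: filter_uniq.
    move=> h; rewrite mem_filter => /andP[/hasP[z zh zg] _].
    have /mapP[x xAQ zx] := zh.
    apply/allpairsP; exists (x, z); split => //=.
    by rewrite zx mulKg.
  - by lra.
  - by lra.
  move=> g gB.
  (* Chernoff bound, with exponentials written as products over points. For [c] equal to [d / 4] or
     its opposite, a bad event makes one of the two tails at least [1], while each factor has mean
     at most [expR (2 * c ^+ 2 - d ^+ 2 / 4) = expR (- (d ^+ 2 / 8))]. *)
  pose tail c E : R := \sum_(a <- A) \prod_(x <- [seq a * t * g | t <- Q]%g)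
     expR (c * ((E x)%:R - f x) - d ^+ 2 / 4).
  have Ebad E : (bad g E)%:R <= tail (d / 4) E + tail (- (d / 4)) E.
    have tail0 c : 0 <= tail c E.
      by apply: sumr_ge0 => a _; apply: prodr_ge0 => t _; apply: expR_ge0.
    have [/hasP[a aA dQ]|_] := boolP (bad g E); last exact: addr_ge0.
    (* For these two values of [c] the factor [4 / d * c] is the sign of [c], so both one-sided
       deviations are covered. *)
    have ge1 c : d * (size Q)%:R <= 4 / d * c * dev a g E -> 1 <= tail c E.
      move=> h; rewrite /tail (big_rem a)//= -[leLHS]addr0.
      apply: lerD; last first.
        by apply: sumr_ge0 => a' _; apply: prodr_ge0 => t _; apply: expR_ge0.
      rewrite -expR_sum -[leLHS]expR0 ler_expR big_map.
      rewrite sumrB -mulr_sumr -/(dev a g E).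
      rewrite big_const_seq count_predT iter_addr_0.
      rewrite -[_ *+ size Q]mulr_natr.
      have : 0 <= (4 / d * c * dev a g E - d * (size Q)%:R) * (d / 4).
        by rewrite mulr_ge0 ?divr_ge0 ?subr_ge0//; lra.
      have -> : (4 / d * c * dev a g E - d * (size Q)%:R) * (d / 4) =
        c * dev a g E - d ^+ 2 / 4 * (size Q)%:R by field; lra.
      by [].
    move: dQ; rewrite /=; have [dv|dv] := leP 0 (dev a g E).
      rewrite ger0_norm// => dQ.
      have : 1 <= tail (d / 4) E.
        apply: ge1; rewrite (_ : 4 / d * (d / 4) = 1) ?mul1r ?ltW//.
        by field; lra.
      by have := tail0 (- (d / 4)); lra.
    rewrite ltr0_norm// => dQ.
    have : 1 <= tail (- (d / 4)) E.
      apply: ge1; rewrite (_ : 4 / d * - (d / 4) = -1) ?mulN1r ?ltW//.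
      by field; lra.
    by have := tail0 (d / 4); lra.
  apply: (le_trans (expect_le f01 _ _ Ebad)).
  have Etail c : `|c| = d / 4 -> expect f l (tail c) xpred0 <=
      (size A)%:R * expR (- (d ^+ 2 / 8 * (size Q)%:R)).
    move=> cd; rewrite expect_sum.
    have -> : (size A)%:R * expR (- (d ^+ 2 / 8 * (size Q)%:R)) =
        \sum_(a <- A) expR (- (d ^+ 2 / 8 * (size Q)%:R)) :> R.
      by rewrite big_const_seq count_predT iter_addr_0 mulr_natl.
    rewrite !big_seq; apply: ler_sum => a aA.
    rewrite (@expect_prod R G f l [seq a * t * g | t <- Q]%g
      (fun x b => expR (c * ((b : bool)%:R - f x) - d ^+ 2 / 4))).
    + rewrite (_ : - (d ^+ 2 / 8 * (size Q)%:R) =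
        \sum_(x <- [seq a * t * g | t <- Q]%g) - (d ^+ 2 / 8)); last first.
        rewrite big_const_seq count_predT iter_addr_0 size_map.
        by rewrite -[RHS]mulr_natr mulNr.
      rewrite expR_sum; apply: ler_prod => x _; apply/andP; split.
        have /andP[fx0 fx1] := f01 x.
        by rewrite addr_ge0 ?mulr_ge0 ?expR_ge0//; lra.
      have c2 : c ^+ 2 = d ^+ 2 / 16.
        by rewrite -real_normK ?num_real// cd; field.
      rewrite !expRD !mulrA -mulrDl.
      rewrite (_ : - (d ^+ 2 / 8) = 2 * c ^+ 2 + - (d ^+ 2 / 4)); last first.
        by rewrite c2; field.
      rewrite expRD ler_wpM2r ?expR_ge0// bernoulli_mgf//; lra.
    + by rewrite map_inj_uniq// => t t' /mulIg /mulgI.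
    + move=> x /mapP[t tQ ->]; apply/flattenP; exists (U g); first exact: map_f.
      exact: inU.
  rewrite expectD.
  have e1 := Etail (d / 4) (ger0_norm _).
  have e2 := Etail (- (d / 4)).
  rewrite normrN in e2.
  have d4 : 0 <= d / 4 by lra.
  apply: (le_trans (lerD (e1 d4) (e2 (ger0_norm d4)))).
  have bern : 2^-1 <= (1 - r) ^+ D.
    by apply: le_trans (bernoulli_ineq D _); rewrite ?rD; lra.
  rewrite subKr; apply: (@le_trans _ _ (r / 2)); last by rewrite ler_pM2l.
  rewrite -mulrDl expRN ler_pdivrMr ?expR_gt0//.
  (* As [r / 2 = 1 / (4 * D)] and [D] is the square of [size A * size Q], the middle term equals
     [2 * size A], the coefficient left by the two tails; this explains the constant [8]. *)
  apply: (@le_trans _ _ (r / 2 * (8 * (size A)%:R ^+ 3 * (size Q)%:R ^+ 2))).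
    rewrite /r /D sAQ !natrM.
    have A1 : (size A)%:R != 0 :> R by rewrite pnatr_eq0 size_eq0.
    have Q1 : (size Q)%:R != 0 :> R by rewrite pnatr_eq0 -lt0n.
    rewrite [leRHS](_ : _ = (size A)%:R + (size A)%:R)//; field.
    by rewrite A1 Q1.
  by rewrite ler_pM2l// divr_gt0.
exists E => a g aA gB; rewrite leNgt; apply/negP => lt.
by have /hasP := goodE g gB; apply; exists a.
Qed.

End Rounding.

(** * Finitely supported means *)

(** Source of the compactness arguments. The lists containing a given finite list generate a proper
    filter, concatenation serving for intersections; any ultrafilter above it works. *)
Lemma exists_ultra_finite (T : eqType) : exists U : set_system (seq T),
  UltraFilter U /\ forall x : T, U [set s : seq T | x \in s].
Proof.
pose F : set_system (seq T) :=
  filter_from setT (fun s : seq T => [set s' : seq T | {subset s <= s'}]).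
have FF : Filter F.
  apply: filter_from_filter; first by exists [::].
  move=> s s' _ _; exists (s ++ s') => // u /= su.
  by split=> x xs; apply: su; rewrite mem_cat xs ?orbT.
have PF : ProperFilter F.
  by apply: filter_from_proper => // s _; exists s.
have [U [UU FU]] := ultraFilterLemma PF; exists U; split=> // x.
by apply: FU; exists [:: x] => // s xs; apply: xs; rewrite inE.
Qed.

Lemma filter_all_seq (T : Type) (I : eqType) (F : set_system T) (s : seq I)
    (P : I -> set T) : Filter F ->
  (forall i, i \in s -> F (P i)) ->
  F [set x | forall i, i \in s -> P i x].
Proof.
move=> FF; elim: s => [|i s IHs] FP; first by apply: filterE => x i.
have Fs : F [set x | forall j, j \in s -> P j x].
  by apply: IHs => j js; apply: FP; rewrite inE js orbT.
apply: filterS (filterI (FP i (mem_head _ _)) Fs) => x [Pi Ps] j.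
by rewrite inE => /orP[/eqP->//|]; apply: Ps.
Qed.

Section FiniteMeans.
Variables (R : realType) (G : groupType).
Implicit Types (s : seq (R * G)) (f : G -> R) (A B Q : seq G).

Definition weighted_sum s f : R := \sum_(p <- s) p.1 * f p.2.

Definition is_mean s :=
  (forall p, p \in s -> 0 <= p.1) /\ weighted_sum s (fun=> 1) = 1.

Definition conv_mean s s' : seq (R * G) :=
  [seq (p.1 * q.1, (p.2 * q.2)%g) | p <- s, q <- s'].

(** For a mean [s], [eps = 0] and [f = \1_E], the weights of [s], placed on the sets [Xset A E g]
    with [g] in its support, form a convex combination constant on [A]. *)
Definition flat A (eps : R) s f := {in A &, forall a a',
  `|weighted_sum s (fun y => f (a * y)%g) -
    weighted_sum s (fun y => f (a' * y)%g)| <= eps}.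

Definition uniform_mean Q : seq (R * G) := [seq ((size Q)%:R^-1, x) | x <- Q].

Lemma weighted_sumB s f f' : weighted_sum s (fun x => f x - f' x) =
  weighted_sum s f - weighted_sum s f'.
Proof. by rewrite -sumrB; apply: eq_bigr => p _; rewrite mulrBr. Qed.

Lemma weighted_sumZ s c f : weighted_sum s (fun x => c * f x) =
  c * weighted_sum s f.
Proof. by rewrite mulr_sumr; apply: eq_bigr => p _; ring. Qed.

Lemma eq_weighted_sum s f f' : (forall x, x \in unzip2 s -> f x = f' x) ->
  weighted_sum s f = weighted_sum s f'.
Proof. by move=> ff'; apply: eq_big_seq => p ps; rewrite ff' ?map_f. Qed.

Lemma ler_weighted_sum s f f' : is_mean s ->
  (forall x, x \in unzip2 s -> f x <= f' x) ->
  weighted_sum s f <= weighted_sum s f'.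
Proof.
move=> [s0 _] ff'; rewrite /weighted_sum !big_seq; apply: ler_sum => p ps.
by rewrite ler_wpM2l ?s0 ?ff' ?map_f.
Qed.

Lemma weighted_sum_cst s c : is_mean s -> weighted_sum s (fun=> c) = c.
Proof.
move=> [_ s1]; rewrite -[RHS]mulr1 -[in RHS]s1 -weighted_sumZ.
by apply: eq_weighted_sum => x _; rewrite mulr1.
Qed.

Lemma weighted_sum_itv s f : is_mean s -> (forall x, 0 <= f x <= 1) ->
  0 <= weighted_sum s f <= 1.
Proof.
move=> ms f01; rewrite -(weighted_sum_cst 0 ms) -(weighted_sum_cst 1 ms).
by apply/andP; split; apply: ler_weighted_sum => // x _; case/andP: (f01 x).
Qed.

Lemma weighted_sum_close s f f' (e : R) : is_mean s ->
  (forall x, x \in unzip2 s -> `|f x - f' x| <= e) ->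
  `|weighted_sum s f - weighted_sum s f'| <= e.
Proof.
move=> ms ff'; rewrite -weighted_sumB ler_norml.
rewrite -(weighted_sum_cst (- e) ms) -[X in _ <= _ <= X](weighted_sum_cst e ms).
by apply/andP; split; apply: ler_weighted_sum => // x /ff';
  rewrite ler_norml => /andP[].
Qed.

Lemma weighted_sum_exchange s t (f : G -> G -> R) :
  weighted_sum s (fun x => weighted_sum t (f x)) =
  weighted_sum t (fun y => weighted_sum s (f^~ y)).
Proof.
rewrite /weighted_sum; under eq_bigr do rewrite mulr_sumr.
rewrite exchange_big; apply: eq_bigr => q _; rewrite mulr_sumr.
by apply: eq_bigr => p _; rewrite mulrCA.
Qed.

Lemma weighted_sum_conv s t f : weighted_sum (conv_mean s t) f =
  weighted_sum s (fun x => weighted_sum t (fun y => f (x * y)%g)).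
Proof.
rewrite /weighted_sum /conv_mean big_allpairs_dep; apply: eq_bigr => p _.
by rewrite mulr_sumr; apply: eq_bigr => q _ /=; rewrite mulrA.
Qed.

Lemma is_mean_conv s t : is_mean s -> is_mean t -> is_mean (conv_mean s t).
Proof.
move=> ms mt; split.
  move=> _ /allpairsP[[p q] /= [ps qt ->]] /=.
  by apply: mulr_ge0; [apply: ms.1|apply: mt.1].
rewrite weighted_sum_conv (weighted_sum_cst _ mt).
exact: weighted_sum_cst.
Qed.

Lemma unzip2_conv s t x : x \in unzip2 (conv_mean s t) ->
  exists y z, [/\ y \in unzip2 s, z \in unzip2 t & x = (y * z)%g].
Proof.
move=> /mapP[_ /allpairsP[[p q] /= [ps qt ->]] ->] /=.
by exists p.2, q.2; split; rewrite ?map_f.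
Qed.

Lemma weighted_sum_uniform Q f :
  weighted_sum (uniform_mean Q) f = (size Q)%:R^-1 * \sum_(t <- Q) f t.
Proof. by rewrite /weighted_sum big_map mulr_sumr. Qed.

Lemma unzip2_uniform Q : unzip2 (uniform_mean Q) = Q.
Proof. by rewrite /unzip2 /uniform_mean -map_comp map_id. Qed.

Lemma is_mean_uniform Q : (0 < size Q)%N -> is_mean (uniform_mean Q).
Proof.
move=> Q0; split; first by move=> p /mapP[t _ ->]; rewrite invr_ge0.
rewrite weighted_sum_uniform big_const_seq count_predT iter_addr_0.
by rewrite mulVf// pnatr_eq0 -lt0n.
Qed.

(** Compactness: if every [B] failed on some [Ebad B], a mean flattening the ultralimit [E] of these
    sets would also flatten [Ebad B] for some [B] that contains its support and for which [Ebad B]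
    agrees with [E] on the finitely many points involved. *)
Lemma uniform_sets A :
  (forall E : set G, exists2 s, is_mean s & flat A 0 s \1_E) ->
  exists B, forall E : set G, exists s,
    [/\ is_mean s, {subset unzip2 s <= B} & flat A 0 s \1_E].
Proof.
move=> flatE; apply: contrapT => noB.
have /choice[Ebad EbadP] : forall B, exists E : set G, forall s, is_mean s ->
    {subset unzip2 s <= B} -> ~ flat A 0 s \1_E.
  move=> B; apply: contrapT => hB; apply: noB; exists B => E.
  apply: contrapT => hE; apply: hB; exists E => s ms sB fs.
  by apply: hE; exists s.
have [U [UU Ux]] := exists_ultra_finite G.
have UF : ProperFilter U by exact: ultra_proper.
pose E : set G := [set x | U [set B | Ebad B x]].
have [s ms fs] := flatE E.
pose near_E x : set (seq G) := [set B | \1_(Ebad B) x = \1_E x :> R].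
have Unear x : U (near_E x).
  have [UE|UE] := in_ultra_setVsetC [set B | Ebad B x] UU.
    by apply: filterS (UE) => B /= BE; rewrite /near_E/= !indicE !mem_set.
  apply: filterS (UE) => B /= BE; rewrite /near_E/= !indicE !memNset// => EU.
  by have [C []] := filter_ex (filterI EU UE).
have Us := filter_all_seq (@filter_filter _ _ UF)
  (fun x (_ : x \in unzip2 s) => Ux x).
have UA := filter_all_seq (@filter_filter _ _ UF)
  (fun x (_ : x \in [seq (a * y)%g | a <- A, y <- unzip2 s]) => Unear x).
have [B [/= sB BE]] := filter_ex (filterI Us UA).
apply: (EbadP B s ms sB) => a a' aA a'A.
have eqE b : b \in A -> weighted_sum s (fun y => \1_(Ebad B) (b * y)%g) =
    weighted_sum s (fun y => \1_E (b * y)%g).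
  move=> bA; apply: eq_weighted_sum => y ys; apply: BE.
  by apply/allpairsP; exists (b, y).
by rewrite !eqE//; apply: fs.
Qed.

(** The order of choices matters: [Q] depends only on [A] and [eps], then [B] serves all sets on the
    products of [A] and [Q], and only then is [f] rounded, with control over the translates by
    [B]. *)
Lemma uniform_functions :
  (forall A, exists B, forall E : set G, exists s,
    [/\ is_mean s, {subset unzip2 s <= B} & flat A 0 s \1_E]) ->
  forall A (eps : R), 0 < eps ->
  exists B, forall f, (forall x, 0 <= f x <= 1) -> exists s,
    [/\ is_mean s, {subset unzip2 s <= B} & flat A eps s f].
Proof.
move=> setsB A eps eps0.
(* Rounding needs arbitrarily large [Q]; in a finite group the uniform mean is invariant and settles
   the claim. *)
have [/finite_seqP[Q0 GQ]|infG] := pselect (finite_set [set: G]).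
  pose Q := undup Q0.
  have allQ x : x \in Q by rewrite mem_undup; have : [set` Q0] x by rewrite -GQ.
  exists Q => f f01; exists (uniform_mean Q); split.
  - by apply: is_mean_uniform; case: (Q) (allQ 1%g).
  - by rewrite unzip2_uniform.
  have transl a : \sum_(t <- Q) f (a * t)%g = \sum_(t <- Q) f t.
    rewrite -(big_map (fun t => a * t)%g predT f); apply: perm_big.
    apply: uniq_perm; rewrite ?undup_uniq ?map_inj_uniq ?undup_uniq//.
      exact: mulgI.
    move=> x; rewrite allQ; apply/mapP; exists (a^-1 * x)%g => //.
    by rewrite mulVKg.
  move=> a a' _ _; rewrite !weighted_sum_uniform !transl subrr normr0.
  exact: ltW.
pose d := Num.min 1 (eps / 2).
have d0 : 0 < d by rewrite lt_min ltr01 divr_gt0.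
have d1 : d <= 1 by rewrite ge_min lexx.
have d2 : d <= eps / 2 by rewrite ge_min lexx orbT.
have k0 : 0 < d ^+ 2 / 8 by rewrite divr_gt0 ?exprn_gt0.
have [n nP] := expR_dominates_square (8 * (size A)%:R ^+ 3) k0.
have [Q uQ nQ] : exists2 Q : seq G, uniq Q & (n < size Q)%N.
  have [X _ nX] := infinite_set_fset n.+1 infG.
  by exists (finmap.enum_fset X) => //; apply: finmap.fset_uniq.
have Q0 : (0 < size Q)%N by exact: leq_ltn_trans nQ.
have [B BP] := setsB [seq (a * t)%g | a <- A, t <- Q].
exists [seq (t * y)%g | t <- Q, y <- B] => f f01.
have [E EP] := rounding B f01 uQ Q0 d0 d1 (nP _ (ltnW nQ)).
have [s [ms sB fs]] := BP [set x | E x].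
have mQ := is_mean_uniform Q0.
exists (conv_mean (uniform_mean Q) s); split.
- exact: is_mean_conv.
- move=> x /unzip2_conv[y [z [yQ zs ->]]].
  rewrite unzip2_uniform in yQ.
  by apply/allpairsP; exists (y, z); split=> //=; apply: sB.
pose F a := weighted_sum (conv_mean (uniform_mean Q) s) (fun y => f (a * y)%g).
pose FE a := weighted_sum (conv_mean (uniform_mean Q) s)
  (fun y => \1_[set x | E x] (a * y)%g) : R.
(* Summing over [Q] first, with [y] in [B] fixed, gives the averages that the rounding controls. *)
have closeF a : a \in A -> `|F a - FE a| <= eps / 2.
  move=> aA; rewrite distrC /F /FE !weighted_sum_conv.
  rewrite !(weighted_sum_exchange (uniform_mean Q)).
  apply: weighted_sum_close => // y ys; rewrite -weighted_sumB.
  rewrite weighted_sum_uniform normrM ger0_norm ?invr_ge0//.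
  rewrite ler_pdivrMl ?ltr0n// mulrC.
  apply: (@le_trans _ _ (d * (size Q)%:R)); last first.
    by rewrite ler_pM2r ?ltr0n.
  have := EP a y aA (sB y ys); congr (`|_| <= _).
  apply: eq_bigr => t _; rewrite mulgA indicE; congr (_%:R - _).
  by congr nat_of_bool; apply/idP/idP => h; rewrite ?inE in h *.
have FEconst a a' : a \in A -> a' \in A -> FE a = FE a'.
  move=> aA a'A.
  (* [s] is exactly flat for [E] on the products of [A] and [Q], so all inner sums equal the one at
     a single reference product. *)
  have h b t : b \in A -> t \in Q ->
      weighted_sum s (fun y => \1_[set x | E x] (b * (t * y))%g) =
      weighted_sum s (fun y => \1_[set x | E x] (a * head 1%g Q * y)%g) :> R.
    move=> bA tQ; rewrite (_ : weighted_sum s _ =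
      weighted_sum s (fun y => \1_[set x | E x] (b * t * y)%g)); last first.
      by apply: eq_weighted_sum => y _; rewrite mulgA.
    apply/eqP; rewrite -subr_eq0 -normr_le0; apply: fs.
      by apply/allpairsP; exists (b, t).
    by apply/allpairsP; exists (a, head 1%g Q); case: (Q) Q0 => //= q Q' _;
      rewrite mem_head.
  rewrite /FE !weighted_sum_conv.
  have const b : b \in A -> weighted_sum (uniform_mean Q) (fun t =>
        weighted_sum s (fun y => \1_[set x | E x] (b * (t * y))%g)) =
      weighted_sum s (fun y => \1_[set x | E x] (a * head 1%g Q * y)%g) :> R.
    move=> bA; rewrite -[RHS](weighted_sum_cst _ mQ).
    by apply: eq_weighted_sum => t; rewrite unzip2_uniform; apply: h.
  by rewrite !const.
move=> a a' aA a'A; rewrite -/(F a) -/(F a').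
rewrite (_ : F a - F a' = (F a - FE a) - (F a' - FE a')); last first.
  by rewrite (FEconst a a')//; ring.
apply: (le_trans (ler_normB _ _)).
by rewrite [leRHS](splitr eps) lerD ?closeF.
Qed.

End FiniteMeans.

(** * From finitely many functions to an invariant mean *)

Lemma indic_itv (R : realType) (T : Type) (E : set T) x :
  0 <= (\1_E x : R) <= 1.
Proof. by rewrite indicE; case: (x \in E); rewrite ?lexx ler01. Qed.

Lemma indic_disjointU (R : realType) (T : Type) (E F : set T) x :
  E `&` F = set0 -> \1_(E `|` F) x = \1_E x + \1_F x :> R.
Proof.
move=> EF; rewrite !indicE in_setU -natrD; congr (_%:R).
case: (boolP (x \in E)) (boolP (x \in F)) => [xE|xE] [xF|xF] //=.
have : (E `&` F) x := conj (set_mem xE) (set_mem xF).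
by rewrite EF.
Qed.

Section Amenability.
Variables (R : realType) (G : groupType).

(** [s1] depends on [s0], while [s0] must be flat on the products of [A] with the support of [s1]; a
    [B] chosen independently of the function breaks this circle. *)
Lemma flat_simultaneous :
  (forall (A : seq G) (eps : R), 0 < eps ->
    exists B : seq G, forall f, (forall x, 0 <= f x <= 1) -> exists s,
      [/\ is_mean s, {subset unzip2 s <= B} & flat A eps s f]) ->
  forall n (f : nat -> G -> R), (forall i x, 0 <= f i x <= 1) ->
  forall A eps, 0 < eps -> exists2 s : seq (R * G), is_mean s &
    forall i, (i < n)%N -> flat A eps s (f i).
Proof.
move=> unif n f f01; elim: n => [|n IHn] A eps eps0.
  by exists (uniform_mean R [:: 1%g]) => //; apply: is_mean_uniform.
have [B BP] := unif A eps eps0.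
have [s0 ms0 fs0] := IHn [seq (a * b)%g | a <- A, b <- B] eps eps0.
have [|s1 [ms1 s1B fs1]] :=
    BP (fun x => weighted_sum s0 (fun y => f n (x * y)%g)).
  by move=> x; apply: weighted_sum_itv.
exists (conv_mean s1 s0); first exact: is_mean_conv.
move=> i; rewrite ltnS leq_eqVlt => /orP[/eqP -> | i_lt] a a' aA a'A.
  rewrite !weighted_sum_conv.
  suff e b :
      weighted_sum s1
        (fun x => weighted_sum s0 (fun y => f n (b * (x * y))%g)) =
      weighted_sum s1 (fun x => weighted_sum s0 (fun y => f n (b * x * y)%g)).
    by rewrite !e; apply: fs1.
  apply: eq_weighted_sum => x _; apply: eq_weighted_sum => y _.
  by rewrite mulgA.
rewrite !weighted_sum_conv; apply: weighted_sum_close => // x xs1.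
rewrite (_ : weighted_sum s0 _ = weighted_sum s0 (fun y => f i (a * x * y)%g)).
  rewrite (_ : weighted_sum s0 (fun y => f i (a' * (x * y))%g) =
    weighted_sum s0 (fun y => f i (a' * x * y)%g)).
    by apply: fs0 => //; [apply/allpairsP; exists (a, x)|
      apply/allpairsP; exists (a', x)]; rewrite /= s1B.
  by apply: eq_weighted_sum => y _; rewrite mulgA.
by apply: eq_weighted_sum => y _; rewrite mulgA.
Qed.

(** * Limits of bounded families along an ultrafilter *)

Section UltraLimit.
Variables (K : Type) (U : set_system K).
Hypothesis UU : UltraFilter U.

Let UP : ProperFilter U. Proof. exact: ultra_proper. Qed.

Definition ulim (u : K -> R) (l : R) :=
  forall e, 0 < e -> U [set k | `|u k - l| <= e].

(** The limit is the supremum of the [r] with [r <= u k] for almost all [k]; the ultrafilter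
    dichotomy gives the matching upper bound. *)
Lemma ulim_exists u : (forall k, 0 <= u k <= 1) -> exists2 l, 0 <= l & ulim u l.
Proof.
move=> u01; pose S : set R := [set r | U [set k | r <= u k]].
have S0 : S 0 by apply: filterE => k /=; case/andP: (u01 k).
have Sub : ubound S 1.
  by move=> r /filter_ex[k /= ru]; apply: le_trans ru _; case/andP: (u01 k).
have Ssup : has_sup S by split; [exists 0|exists 1].
exists (sup S); first exact: (sup_upper_bound Ssup).
move=> e e0; have [r Sr rl] := sup_adherent e0 Ssup.
have Ule : U [set k | u k <= sup S + e].
  have [Uc|] := in_ultra_setVsetC [set k | sup S + e <= u k] UU.
    have := @sup_upper_bound _ _ Ssup (sup S + e) Uc.
    by move=> ?; exfalso; lra.
  by apply: filterS => k /= /negP; rewrite -ltNge => /ltW.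
apply: filterS (filterI Sr Ule) => k /= [rk ku].
by rewrite ler_norml; apply/andP; split; lra.
Qed.

Lemma ulim_eq u v l m : ulim u l -> ulim v m -> ulim (fun k => u k - v k) 0 ->
  l = m.
Proof.
move=> ul vm uv; apply/eqP; rewrite -subr_eq0 -normr_le0.
apply/ler_addgt0Pl => e e0.
have e3 : 0 < e / 3 by rewrite divr_gt0.
have [k /= [[]]] := filter_ex (filterI (filterI (ul _ e3) (vm _ e3)) (uv _ e3)).
rewrite !ler_norml => /andP[h1 h2] /andP[h3 h4] /andP[h5 h6].
by apply/andP; split; lra.
Qed.

Lemma ulimD u v l m : ulim u l -> ulim v m -> ulim (fun k => u k + v k) (l + m).
Proof.
move=> ul vm e e0; have e2 : 0 < e / 2 by rewrite divr_gt0.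
apply: filterS (filterI (ul _ e2) (vm _ e2)) => k /=.
rewrite !ler_norml => -[/andP[h1 h2] /andP[h3 h4]].
by apply/andP; split; lra.
Qed.

Lemma ulim_cst c : ulim (fun=> c) c.
Proof. by move=> e e0; apply: filterE => k /=; rewrite subrr normr0 ltW. Qed.

End UltraLimit.

(** A triple [(g, E, n)] is the demand that translating [E] by [g] change its mean by at most
    [1 / (n + 1)]. Finitely many demands are met at once, and the ultralimit over lists of demands
    meets them all. *)
Lemma amenable_of_flat :
  (forall n (f : nat -> G -> R), (forall i x, 0 <= f i x <= 1) ->
   forall A eps, 0 < eps -> exists2 s : seq (R * G), is_mean s &
     forall i, (i < n)%N -> flat A eps s (f i)) ->
  amenable R G.
Proof.
move=> simul; pose T : eqType := (G * set G * nat)%type.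
pose tr g E : set G := [set (g * x)%g | x in E].
have /choice[s sP] : forall k : seq T, exists s : seq (R * G), is_mean s /\
    forall g E n, (g, E, n) \in k ->
      `|weighted_sum s \1_(tr g E) - weighted_sum s \1_E| <= n.+1%:R^-1.
  (* [N] is the finest precision demanded in [k]. Flatness is used at [1] and the inverses, since
     the indicator of [g E] at [x] is that of [E] at [g^-1 * x]. *)
  move=> k; pose N := \max_(x <- k) x.2.
  have [] := simul (size k) (fun i => \1_(nth (1%g, set0, 0%N) k i).1.2) _
    (1%g :: [seq x.1.1^-1%g | x <- k]) N.+1%:R^-1.
  - by move=> i x; apply: indic_itv.
  - by rewrite invr_gt0.
  move=> s ms fs; exists s; split=> // g E n gEk.
  have ik : (index (g, E, n) k < size k)%N by rewrite index_mem.
  have gA : g^-1%g \in [seq x.1.1^-1%g | x <- k].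
    by apply/mapP; exists (g, E, n).
  have := fs _ ik g^-1%g 1%g; rewrite !inE gA eqxx orbT nth_index//=.
  move=> /(_ isT isT).
  rewrite (_ : weighted_sum s (fun y => \1_E (g^-1 * y)%g) =
    weighted_sum s \1_(tr g E)); last first.
    apply: eq_weighted_sum => x _; rewrite !indicE; congr (nat_of_bool _)%:R.
    apply/idP/idP => [/set_mem Ex|/set_mem[y Ey <-]]; apply/mem_set.
      by exists (g^-1 * x)%g; rewrite ?mulVKg.
    by rewrite mulKg.
  rewrite (_ : weighted_sum s (fun y => \1_E (1 * y)%g) =
    weighted_sum s \1_E); last by apply: eq_weighted_sum => x _; rewrite mul1g.
  move=> /le_trans; apply; rewrite lef_pV2 ?posrE// ler_nat ltnS.
  by rewrite /N; apply: (@leq_bigmax_seq _ _ _ (fun x : T => x.2) _ gEk).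
have ms k : is_mean (s k) := (sP k).1.
have [U [UU Ux]] := exists_ultra_finite T.
have UP : ProperFilter U by exact: ultra_proper.
have /choice[mu muP] : forall E, exists l : R, 0 <= l /\
    ulim U (fun k => weighted_sum (s k) \1_E) l.
  move=> E.
  have [k|l] := ulim_exists UU (u := fun k => weighted_sum (s k) \1_E).
    by apply: weighted_sum_itv => // x; apply: indic_itv.
  by exists l.
have muT : mu setT = 1.
  apply: (ulim_eq UU (muP _).2 (ulim_cst UU 1)) => e e0; apply: filterE => k /=.
  rewrite (_ : weighted_sum _ _ = 1); first by rewrite !subrr normr0 ltW.
  rewrite -[RHS](weighted_sum_cst 1 (ms k)); apply: eq_weighted_sum => x _.
  by rewrite indicT.
exists mu.
  split=> //; first by move=> E; exact: (muP E).1.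
  move=> E F EF; apply: (ulim_eq UU (muP _).2 (ulimD UU (muP E).2 (muP F).2)).
  move=> e e0; apply: filterE => k /=.
  rewrite (_ : weighted_sum _ \1_(E `|` F) =
    weighted_sum (s k) \1_E + weighted_sum (s k) \1_F).
    by rewrite !subrr normr0 ltW.
  rewrite /weighted_sum -big_split; apply: eq_bigr => p _ /=.
  by rewrite -mulrDr; congr (_ * _); apply: indic_disjointU.
move=> g E; apply: (ulim_eq UU (muP _).2 (muP _).2) => e e0.
pose n := Num.bound e^-1.
apply: filterS (Ux (g, E, n)) => k /= gEk; rewrite subr0.
apply: le_trans ((sP k).2 _ _ _ gEk) _.
rewrite -[leRHS]invrK lef_pV2 ?posrE ?invr_gt0//.
apply: le_trans (ltW (archi_boundP _)) _; first by rewrite invr_ge0 ltW.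
by rewrite ler_nat.
Qed.

End Amenability.

(** * Ramsey sets *)

Section FiniteRamsey.
Variables (R : realType) (G : groupType).
Implicit Types (s : seq (R * G)) (mu nu : set G -> R) (A E : set G).

(** * Point masses and convolution *)

Lemma finadd_prob0 (T : Type) (A : set T) (mu : set T -> R) :
  finadd_prob A mu -> mu set0 = 0.
Proof.
case=> _ muU _ _; have := muU set0 set0 (setI0 _); rewrite setU0.
by lra.
Qed.

Lemma finadd_probS A mu E F : finadd_prob A mu -> E `<=` F -> mu E <= mu F.
Proof.
case=> mu0 muU _ _ EF; rewrite (_ : F = E `|` (F `\` E)).
  rewrite muU ?lerDl//; apply/seteqP; split => x // [Ex [_ NEx]].
  exact: NEx.
by apply/seteqP; split => x; [have [|] := pselect (E x); [left|right]|
  case=> [/EF|[]]].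
Qed.

Lemma finadd_prob_setC A mu x : finadd_prob A mu -> ~ A x -> mu [set x] = 0.
Proof.
move=> muA xA; have [mu0 muU mu1 muA1] := muA.
have : mu (A `|` [set x]) <= 1 by rewrite -mu1; apply: finadd_probS muA _.
rewrite muU ?muA1; first by have := mu0 [set x]; lra.
by apply/seteqP; split => // y [Ay yx]; rewrite yx in Ay.
Qed.

Lemma finadd_prob_sum A mu (t : seq G) : finadd_prob A mu -> uniq t ->
  \sum_(x <- t) mu [set x] = mu [set` t].
Proof.
move=> muA; elim: t => [_|x t IHt /= /andP[xt ut]].
  rewrite big_nil -(finadd_prob0 muA); congr mu.
  by apply/seteqP; split.
have [_ muU _ _] := muA.
rewrite big_cons IHt// -muU.
  congr mu; apply/seteqP; split => y /=; rewrite inE.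
    by case=> [->|yt]; rewrite ?eqxx// yt orbT.
  by case/orP => [/eqP|]; [left|right].
by apply/seteqP; split => // y [-> /=]; rewrite (negPf xt).
Qed.

(** Nonnegative point masses make the negative part vanish, and pairs outside [A] and [B] contribute
    zero to the extended sum. *)
Lemma conv_finite mu nu (A B : seq G) E : uniq A -> uniq B ->
  (forall x, 0 <= mu [set x]) -> (forall y, 0 <= nu [set y]) ->
  (forall x, x \notin A -> mu [set x] = 0) ->
  (forall y, y \notin B -> nu [set y] = 0) ->
  conv mu nu E =
  \sum_(x <- A) mu [set x] * (\sum_(y <- B) nu [set y] * \1_E (x * y)%g).
Proof.
move=> uA uB mu0 nu0 muA nuB; rewrite /conv /=.
set f := (fun p : G * G => EFin _); set D := [set p | _].
have f0 p : (0 <= f p)%E by rewrite lee_fin mulr_ge0.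
have fpos : (f^\+ = f)%E.
  by apply/funext => p; rewrite funeposE; apply/max_idPl.
have fneg : (f^\- = cst 0)%E.
  by apply/funext => p; rewrite funenegE; apply/max_idPr; rewrite leeNl oppe0.
rewrite fpos fneg [X in (_ - X)%E]esum1// sube0.
pose X : seq (G * G) := [seq (x, y) | x <- A, y <- B].
rewrite (esumID [set` X])// [X in (_ + X)%E]esum1 ?adde0; last first.
  move=> [x y] [_ /= /negP XN]; rewrite /f/=.
  have [xA|xA] := boolP (x \in A); last by rewrite muA// mul0r.
  rewrite nuB ?mulr0//; apply: contraNN XN => yB.
  by apply/allpairsP; exists (x, y).
have uX : uniq X by apply: allpairs_uniq => // -[a b] [c d].
have finX : finite_set [set` X] by apply/finite_seqP; exists X.
rewrite setIC esum_mkcondr esum_fset//; last by move=> p _; case: ifP.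
rewrite -fsbig_seq//.
rewrite big_allpairs (_ : (\big[_/_]_(i <- A) _)%E =
  (\sum_(x <- A)
    mu [set x] * (\sum_(y <- B) nu [set y] * \1_E (x * y)%g))%:E) //.
rewrite -sumEFin; apply: eq_bigr => x _; rewrite mulr_sumr -sumEFin.
apply: eq_bigr => y _; rewrite indicE /f /=.
rewrite (_ : ((x, y) \in D) = ((x * y)%g \in E)).
  by case: ifP => _; rewrite ?mulr1 ?mulr0.
by apply/idP/idP => /set_mem h; apply/mem_set.
Qed.

Definition mean_measure s : set G -> R := fun E => weighted_sum s \1_E.

Lemma finadd_prob_mean A s : is_mean s -> (forall x, x \in unzip2 s -> A x) ->
  finadd_prob A (mean_measure s).
Proof.
move=> ms sA; have [s0 _] := ms; split.
- by move=> E; have /andP[] := weighted_sum_itv ms (indic_itv R E).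
- move=> E F EF; rewrite /mean_measure /weighted_sum -big_split.
  apply: eq_bigr => p _ /=; rewrite -mulrDr; congr (_ * _).
  exact: indic_disjointU.
- rewrite -[RHS](weighted_sum_cst 1 ms); apply: eq_weighted_sum => x _.
  by rewrite indicT.
- rewrite -[RHS](weighted_sum_cst 1 ms); apply: eq_weighted_sum => x xs.
  by rewrite indicE mem_set//; apply: sA.
Qed.

(** [s] may list a point several times; [mean_measure s] gathers the weights, hence the sum over the
    support without repetitions. *)
Lemma sum_mean_measure s (f : G -> R) :
  \sum_(y <- undup (unzip2 s)) mean_measure s [set y] * f y = weighted_sum s f.
Proof.
under eq_bigr do rewrite mulr_suml.
rewrite exchange_big; apply: eq_big_seq => p ps /=.
rewrite (big_rem p.2) ?mem_undup ?map_f//= indicE mem_set// mulr1.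
rewrite big1_seq ?addr0//.
move=> y /= yp; rewrite indicE memNset ?mulr0 ?mul0r// => /= py.
by move: yp; rewrite mem_rem_uniq ?undup_uniq// py inE eqxx.
Qed.

Lemma conv_mean_measure mu (A : seq G) s E :
  finadd_prob [set` A] mu -> uniq A -> is_mean s ->
  conv mu (mean_measure s) E =
  \sum_(x <- A) mu [set x] * weighted_sum s (fun y => \1_E (x * y)%g).
Proof.
move=> muA uA ms.
have nuP := finadd_prob_mean (A := [set` unzip2 s]) ms (fun=> id).
rewrite (conv_finite E uA (undup_uniq (unzip2 s))).
- by apply: eq_bigr => x _; rewrite sum_mean_measure.
- by case: muA.
- by case: nuP.
- by move=> x xA; apply: finadd_prob_setC muA _ => /=; exact/negP.
- move=> y; rewrite mem_undup => ys.
  by apply: finadd_prob_setC nuP _ => /=; exact/negP.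
Qed.

(** Splitting by the sets of [Fs] in turn yields finitely many atoms, and each nonempty atom gets
    one point carrying its measure. The induction splits [C], which is why [C] is arbitrary. *)
Lemma mean_approx mu (Fs : seq (set G)) C : finadd_prob setT mu ->
  exists s, [/\ forall p, p \in s -> 0 <= p.1, forall p, p \in s -> C p.2,
    weighted_sum s (fun=> 1) = mu C &
    forall F, F \in Fs -> weighted_sum s \1_F = mu (C `&` F)].
Proof.
move=> muP; have [mu0 muU _ _] := muP.
elim: Fs C => [|F Fs IHFs] C.
  have [[x Cx]|C0] := pselect (exists x, C x).
    exists [:: (mu C, x)]; split=> [p|p||//].
    - by rewrite inE => /eqP->; apply: mu0.
    - by rewrite inE => /eqP->.
    - by rewrite /weighted_sum big_seq1 mulr1.
  (* An empty atom has measure zero and gets no point. *)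
  exists [::]; split=> //; rewrite /weighted_sum big_nil -(finadd_prob0 muP).
  by congr mu; apply/seteqP; split=> // x Cx; apply: C0; exists x.
have [s [s0 sC s1 sF]] := IHFs (C `&` F).
have [s' [s0' sC' s1' sF']] := IHFs (C `&` ~` F).
have wcat f : weighted_sum (s ++ s') f = weighted_sum s f + weighted_sum s' f.
  by rewrite /weighted_sum big_cat.
have muC D : mu (C `&` F `&` D) + mu (C `&` ~` F `&` D) = mu (C `&` D).
  rewrite -muU; first congr mu; apply/seteqP; split => x //.
  - by case=> -[[]].
  - by case=> Cx Dx; have [Fx|Fx] := pselect (F x); [left|right].
  - by case=> -[[_ Fx] _] [[_ NFx] _].
exists (s ++ s'); split.
- by move=> p; rewrite mem_cat => /orP[/s0|/s0'].
- by move=> p; rewrite mem_cat => /orP[/sC[]|/sC'[]].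
- by rewrite wcat s1 s1'; have := muC setT; rewrite !setIT.
move=> D; rewrite inE wcat => /orP[/eqP->|DFs]; last by rewrite sF// sF'.
rewrite (_ : weighted_sum s \1_F = weighted_sum s (fun=> 1)); last first.
  by apply: eq_weighted_sum => x /mapP[p /sC[_ Fp] ->]; rewrite indicE mem_set.
rewrite (_ : weighted_sum s' \1_F = 0 * weighted_sum s' (fun=> 1)); last first.
  rewrite -weighted_sumZ; apply: eq_weighted_sum => x /mapP[p /sC'[_ Fp] ->].
  by rewrite indicE memNset// mul0r.
by rewrite mul0r addr0 s1.
Qed.

(** By invariance the sets [a^-1 E] all have measure [mu E], and some finitely supported mean agrees
    with [mu] on these finitely many sets. *)
Lemma amenable_flat (A : seq G) E : amenable R G ->
  exists2 s : seq (R * G), is_mean s & flat A 0 s \1_E.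
Proof.
case=> mu muP mu_inv; have [_ _ mu1 _] := muP.
have [s [s0 _ s1 sF]] :=
  mean_approx [seq [set y | E (a * y)%g] | a <- A] setT muP.
exists s; first by split; rewrite // s1.
suff e a : a \in A -> weighted_sum s (fun y => \1_E (a * y)%g) = mu E.
  by move=> a a' aA a'A; rewrite !e// subrr normr0.
move=> aA.
rewrite (_ : weighted_sum s _ = weighted_sum s \1_[set y | E (a * y)%g]).
  rewrite sF; last by apply/mapP; exists a.
  rewrite setTI -(mu_inv a); congr mu.
  apply/seteqP; split => [x [y /= Ey <-]//|x Ex].
  by exists (a^-1 * x)%g; rewrite /= mulVKg.
by apply: eq_weighted_sum => y _; rewrite !indicE.
Qed.

Lemma balanced_flat (A : seq G) E : balanced R [set` A] (Xcoll [set` A] E) ->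
  exists2 s : seq (R * G), is_mean s & flat A 0 s \1_E.
Proof.
case=> v [n [c [S [c0 c1 SY vE]]]] vconst.
have /choice[g gP] : forall i, exists g, Xset [set` A] E g = S i.
  by move=> i; have [g _] := SY i; exists g.
have wE f : weighted_sum [seq (c i, g i) | i <- enum 'I_n] f =
    \sum_(i < n) c i * f (g i).
  by rewrite /weighted_sum big_map big_enum.
exists [seq (c i, g i) | i <- enum 'I_n].
  split; first by move=> p /mapP[i _ ->]; apply: c0.
  by rewrite wE -[RHS]c1; apply: eq_bigr => i _; rewrite mulr1.
have e a : a \in A ->
    weighted_sum [seq (c i, g i) | i <- enum 'I_n] (fun y => \1_E (a * y)%g) =
    v a.
  move=> aA; rewrite wE vE; apply: eq_bigr => i _.
  rewrite -gP !indicE; congr (_ * (nat_of_bool _)%:R).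
  by apply/idP/idP => /set_mem h; apply/mem_set; [split|case: h].
by move=> a a' aA a'A; rewrite !e//; apply: vconst.
Qed.

(** Tested on the point masses of [A], the Ramsey property shows that the weights [nu [set y]]
    balance the sets [Xset A E y]. *)
Lemma zero_ramsey_balanced (A B : seq G) E : zero_ramsey R [set` A] [set` B] ->
  balanced R [set` A] (Xcoll [set` A] E).
Proof.
move=> /(_ (E `&` [set` B]) (@subIsetr _ _ _))[nu [nuB convB convE]].
pose t := undup B.
have tB : [set` t] = [set` B] :> set G.
  by apply/seteqP; split => x /=; rewrite mem_undup.
have [nu0 nuU nu1 nuB1] := nuB.
pose dirac a : set G -> R := fun F => \1_F a.
have diracP a : a \in A -> finadd_prob [set` A] (dirac a).
  move=> aA; split=> [F|F F' FF'||].
  - by have /andP[] := indic_itv R F a.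
  - exact: indic_disjointU.
  - by rewrite /dirac indicT.
  - by rewrite /dirac indicE mem_set.
have convdirac a F : a \in A -> conv (dirac a) nu F =
    \sum_(y <- t) nu [set y] * \1_F (a * y)%g.
  move=> aA; rewrite (@conv_finite _ _ [:: a] t) ?undup_uniq//.
  - by rewrite big_seq1 /dirac indicE mem_set// mul1r.
  - move=> x; rewrite inE => xa; rewrite /dirac indicE memNset//= => ax.
    by rewrite ax eqxx in xa.
  - move=> y; rewrite mem_undup => yB.
    by apply: finadd_prob_setC nuB _; exact/negP.
(* conv (dirac a) nu is concentrated on B, so nu y = 0 unless a y is in B. *)
have stay a y : a \in A -> y \in t ->
    nu [set y] * \1_[set` B] (a * y)%g = nu [set y].
  move=> aA yt.
  have [_ _ _] := convB _ (ex_intro2 _ _ _ (diracP a aA) erefl).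
  rewrite convdirac// => sum1.
  have sum2 : \sum_(y <- t) nu [set y] = 1.
    by rewrite (finadd_prob_sum nuB) ?undup_uniq// tB.
  have /eqP :
      \sum_(y <- t) (nu [set y] - nu [set y] * \1_[set` B] (a * y)%g) = 0.
    by rewrite sumrB sum1 sum2 subrr.
  rewrite psumr_eq0 => [/allP/(_ y yt)/= /eqP/subr0_eq//|z _].
  have /andP[_ le1] := indic_itv R [set` B] (a * z)%g.
  by rewrite subr_ge0 ler_piMr.
pose v x : R := \sum_(i < size t)
  nu [set tnth (in_tuple t) i] * \1_(Xset [set` A] E (tnth (in_tuple t) i)) x.
(* [nu] charges only points [y] with [a * y] in [B], so cutting [E] down to a subset of [B] does not
   alter the value at [a]. *)
have vE a : a \in A -> v a = conv (dirac a) nu (E `&` [set` B]).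
  move=> aA; rewrite convdirac// /v -(big_tnth _ _ t xpredT (fun y =>
    nu [set y] * \1_(Xset [set` A] E y) a)).
  apply: eq_big_seq => y yt; rewrite -[in LHS](stay a y aA yt) -mulrA.
  congr (_ * _); rewrite indicI /= mulrC; congr (_ * _); rewrite !indicE.
  congr (nat_of_bool _)%:R.
  by apply/idP/idP => /set_mem h; apply/mem_set; [case: h|split].
exists v.
  exists (size t), (fun i => nu [set tnth (in_tuple t) i]),
    (fun i => Xset [set` A] E (tnth (in_tuple t) i)).
  split=> // [|i]; last by exists (tnth (in_tuple t) i).
  rewrite -(big_tnth _ _ t xpredT (fun y => nu [set y])).
  by rewrite (finadd_prob_sum nuB) ?undup_uniq// tB.
move=> a a' aA a'A; rewrite !vE// (convE _ _ (diracP a aA) (diracP a' a'A)).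
by rewrite subrr normr0.
Qed.

(** A mean flat for [E] gives all right translates [A y] an averaged indicator constant on [A], so
    every measure on [A] integrates it to the same value. *)
Lemma amenable_zero_ramsey (A : seq G) : amenable R G ->
  exists B : set G, finite_set B /\ zero_ramsey R [set` A] B.
Proof.
move=> amG; pose A' := undup A.
have AA' : [set` A] = [set` A'] :> set G.
  by apply/seteqP; split => x /=; rewrite mem_undup.
have [B BP] := uniform_sets (fun E => amenable_flat A' E amG).
(* The products are added so that convolution with a measure on [A] stays concentrated on [B']. *)
pose B' := B ++ [seq (a * b)%g | a <- A', b <- B].
exists [set` B']; split=> //.
rewrite AA' => E EB; have [s [ms sB fs]] := BP E.
exists (mean_measure s); split.
- by apply: finadd_prob_mean => // x /sB xB /=; rewrite mem_cat xB.
- move=> _ [mu muA <-].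
  have cE F := conv_mean_measure F muA (undup_uniq A) ms.
  have sumA : \sum_(x <- A') mu [set x] = 1.
    by rewrite (finadd_prob_sum muA) ?undup_uniq//; case: muA.
  have [mu0 _ _ _] := muA.
  have full F : (forall x y, x \in A' -> y \in unzip2 s -> F (x * y)%g) ->
      conv mu (mean_measure s) F = 1.
    move=> xyF; rewrite cE -[RHS]sumA; apply: eq_big_seq => x xA.
    rewrite -[RHS]mulr1; congr (_ * _); rewrite -[RHS](weighted_sum_cst 1 ms).
    by apply: eq_weighted_sum => y ys; rewrite indicE mem_set//; apply: xyF.
  split.
  + move=> F; rewrite cE; apply: sumr_ge0 => x _; apply: mulr_ge0 => //.
    by have /andP[] := weighted_sum_itv ms (fun y => indic_itv R F (x * y)%g).
  + move=> F F' FF'; rewrite !cE -big_split; apply: eq_bigr => x _ /=.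
    rewrite -mulrDr; congr (_ * _); rewrite /weighted_sum -big_split.
    apply: eq_bigr => p _ /=; rewrite -mulrDr; congr (_ * _).
    exact: indic_disjointU.
  + exact: full.
  + apply: full => x y xA /sB yB; rewrite /= mem_cat; apply/orP; right.
    by apply/allpairsP; exists (x, y).
move=> mu mu' muA muA'.
rewrite !(@conv_mean_measure _ A')// ?undup_uniq//.
pose w x := weighted_sum s (fun y => \1_E (x * y)%g).
have wconst x : x \in A' -> w x = w (head 1%g A').
  move=> xA; apply/eqP; rewrite -subr_eq0 -normr_le0; apply: fs => //.
  by case: (A') xA => //= a ? _; apply: mem_head.
have const nu : finadd_prob [set` A'] nu ->
    \sum_(x <- A') nu [set x] * w x = w (head 1%g A').
  move=> nuA; transitivity (\sum_(x <- A') nu [set x] * w (head 1%g A')).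
    by apply: eq_big_seq => x xA; rewrite wconst.
  rewrite -mulr_suml (finadd_prob_sum nuA) ?undup_uniq//.
  by case: nuA => _ _ _ ->; rewrite mul1r.
by rewrite !const.
Qed.

End FiniteRamsey.

(** * The cycle of implications *)

Theorem theorem1p5 (R : realType) (G : groupType) :
  [<-> ~ amenable R G;
       exists (A : set G) (Y : set (set G)),
         [/\ finite_set A,
             forall S, Y S -> S `<=` A,
             ~ balanced R A Y
           & realized A Y];
       exists A : set G,
         finite_set A /\
         ~ (exists B : set G, finite_set B /\ zero_ramsey R A B)].
Proof.
tfae.
- move=> NamG; apply: contrapT => noA; apply: NamG.
  apply: amenable_of_flat; apply: flat_simultaneous.
  apply: uniform_functions => A; apply: uniform_sets => E.
  apply: balanced_flat; apply: contrapT => NbalE; apply: noA.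
  exists [set` A], (Xcoll [set` A] E); split=> //.
  + by move=> _ [g _ <-] a [].
  + by exists E.
- move=> [A [Y [/finite_seqP[s ->] _ Nbal [E YE]]]].
  exists [set` s]; split=> //.
  move=> [B [/finite_seqP[t ->] ram]]; apply: Nbal.
  by rewrite YE; apply: zero_ramsey_balanced ram.
- move=> [A [/finite_seqP[s ->] NB]] amG; apply: NB.
  exact: amenable_zero_ramsey.
Qed.
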